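(* Fix $i\in I$. Let $B$ be a block of $\mathcal H_{r,n}$ with $\delta_i(B)\ge0$, let $C$ be the core block of $B$, and assume $w(B)\le w(C)+K_i(C)\,r$. Let $\boldsymbol\lambda$ be any $r$-multipartition of $n$ such that $S^{\boldsymbol\lambda}$ belongs to $B$, and for $1\le j\le r$ let $B^j_{a_j}$ be the set of $\beta$-numbers of $\lambda^{(j)}$ with respect to the multicharge $\mathrm a=(a_1,\dots,a_r)$ of $\mathcal H_{r,n}$. Then: - if $i\ne0$, in no component of $\boldsymbol\lambda$ is there an abacus configuration of the type (bead, empty position) in runners $i-1$ and $i$; that is, there is no $j\in\{1,\dots,r\}$ and no integer $b\equiv i-1\pmod e$ with $b\in B^j_{a_j}$ and $b+1\notin B^j_{a_j}$; - if $i=0$, in no component of $\boldsymbol\lambda$ is there an abacus configuration of the type (bead, empty position) in runners $e-1$ and $0$; that is, there is no $j\in\{1,\dots,r\}$ and no integer $b\equiv e-1\pmod e$ with $b\in B^j_{a_j}$, $b+1\notin B^j_{a_j}$ and $b+e+1\notin B^j_{a_j}$.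
   Context: Setting. Let $r\ge1$, $n\ge 0$, $\mathbb F$ a field, $2\le e<\infty$, $q\in\mathbb F$ a primitive $e$-th root of unity, $\kappa=(\kappa_1,\dots,\kappa_r)\in\mathbb Z^r$, $Q_j=q^{\kappa_j}$, $I=\{0,\dots,e-1\}$ identified with $\mathbb Z/e\mathbb Z$. $\mathcal H_{r,n}$ is the Ariki-Koike algebra over $\mathbb F$ with parameters $q,Q_1,\dots,Q_r$: generators $T_0,\dots,T_{n-1}$ and relations $(T_0-Q_1)\cdots(T_0-Q_r)=0$, $T_0T_1T_0T_1=T_1T_0T_1T_0$, $(T_i+1)(T_i-q)=0$ ($1\le i\le n-1$), $T_iT_j=T_jT_i$ ($0\le i<j-1\le n-2$), $T_iT_{i+1}T_i=T_{i+1}T_iT_{i+1}$ ($1\le i\le n-2$). A multicharge of $\mathcal H_{r,n}$ is any $\mathrm a\in\mathbb Z^r$ with $a_j\equiv\kappa_j \pmod e$ for all $j$. Multipartitions and blocks. An $r$-multipartition of $n$ is an $r$-tuple $\boldsymbol\lambda=(\lambda^{(1)},\dots,\lambda^{(r)})$ of partitions of total size $n$, with nodes $(b,c,j)$, $c\le\lambda^{(j)}_b$; the node $(b,c,j)$ has residue $\kappa_j+c-b \bmod e$. Specht modules $S^{\boldsymbol\lambda}$ are the cell modules of $\mathcal H_{r,n}$; each lies in one block, and $\boldsymbol\lambda$ lies in $B$ if $S^{\boldsymbol\lambda}$ does; two $r$-multipartitions of $n$ lie in the same block iff their multisets of residues coincide. Hub, weight. $\delta_i^j(\boldsymbol\lambda)$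 is the number of removable minus the number of addable nodes of residue $i$ in component $j$; $\delta_i(\boldsymbol\lambda)=\sum_j\delta_i^j(\boldsymbol\lambda)$; the hub is $(\delta_i(\boldsymbol\lambda))_{i\in I}$. With $c_i(\boldsymbol\lambda)$ the number of nodes of residue $i$, the weight is $w(\boldsymbol\lambda)=\sum_{j=1}^r c_{\kappa_j}(\boldsymbol\lambda)-\frac12\sum_{i\in I}(c_i(\boldsymbol\lambda)-c_{i+1}(\boldsymbol\lambda))^2$ (subscripts mod $e$). Both depend only on the block; write $\delta_i(B)$, $w(B)$. Abacus. For a multicharge $\mathrm a$, $B^j_{a_j}=\{\lambda^{(j)}_m+a_j-m: m\ge1\}$ is the set of $\beta$-numbers of $\lambda^{(j)}$. The $e$-abacus of $\lambda^{(j)}$ has runners $0,\dots,e-1$, with a bead at position $xe+l$ (runner $l$, level $x$) for each $\beta$-number $xe+l$. A multicore is a multipartition all of whose components are $e$-cores (all beads pushed up as high as possible). $\ell^{\mathrm a}_{lj}(\boldsymbol\lambda)$ is the level of the lowest bead (largest $\beta$-number) on runner $l$ of the abacus of $\lambda^{(j)}$. Core blocks. A block is a core block if every multipartition in it is a multicore; equivalently, no block of any $\mathcal H_{r,m}$ (same $q,\kappa$) has the same hub and smaller weight. For each hub that occurs there is exactly one core block with that hub; the core block of $B$ is the one with the same hub as $B$. $K_i(C)$. For a core block $C$ and a multicharge $\mathrm a$, a base tuple of $C$ with respect to $\mathrm a$ is $(b_0,\dots,b_{e-1})\in\mathbb Z^e$ such that $\ell^{\mathrm a}_{lj}(\boldsymbol\mu)\in\{b_l,b_l+1\}$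 for all $l\in I$, all $j$ and all $\boldsymbol\mu\in C$. Multicharges admitting a base tuple exist; fix one. Given $i$, choose a base tuple with respect to this multicharge with $b_i$ as large as possible and $b_{i-1}$ (meaning $b_{e-1}$ if $i=0$) as small as possible. Then $K_i(C)=b_i-b_{i-1}-1$ if $i\ne0$ and $K_0(C)=b_0-b_{e-1}-2$. *)

(* Defs.v *)
From HB Require Import structures.
From mathcomp Require Import all_boot all_order all_fingroup all_algebra.
Set Implicit Arguments.
Unset Strict Implicit.
Unset Printing Implicit Defensive.
Import Order.TTheory GRing.Theory Num.Theory.
Local Open Scope ring_scope.

(* Entries, rows, columns and components are numbered from 0 throughout; this
   does not affect residues, which only involve differences c - b. *)

Definition is_partition (s : seq nat) : bool := sorted geq s && (0%N \notin s).

Record partition := Partition {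
  parts :> seq nat;
  _ : is_partition parts
}.

(* 0 beyond the last row *)
Definition part (p : partition) (b : nat) : nat := nth 0%N p b.

Definition multipartition (r : nat) := 'I_r -> partition.

Definition mp_size r (lam : multipartition r) : nat :=
  (\sum_(j < r) sumn (lam j))%N.

Definition dominates r (lam mu : multipartition r) : Prop :=
  forall (s : 'I_r) (t : nat),
    (\sum_(k < r | k < s) sumn (mu k) + \sum_(b < t) part (mu s) b <=
     \sum_(k < r | k < s) sumn (lam k) + \sum_(b < t) part (lam s) b)%N.

Definition strictly_dominates r (lam mu : multipartition r) : Prop :=
  dominates lam mu /\ ~ dominates mu lam.


Section ArikiKoike.
Variables (F : fieldType) (q : F) (r : nat) (kappa : 'I_r -> int) (n : nat).

Definition ak_param (j : 'I_r) : F := q ^ kappa j.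

(* Only T 0, ..., T (n - 1) are generators; other values of T are irrelevant. *)
Definition ak_relations (A : algType F) (T : nat -> A) : Prop :=
  [/\ (0 < n)%N -> \prod_(j < r) (T 0%N - (ak_param j)%:A) = 0,
      (1 < n)%N -> T 0%N * T 1%N * T 0%N * T 1%N = T 1%N * T 0%N * T 1%N * T 0%N,
      forall i, (0 < i < n)%N -> (T i + 1) * (T i - q%:A) = 0,
      forall i j, (i.+1 < j < n)%N -> T i * T j = T j * T i
    & forall i, (0 < i)%N -> (i.+1 < n)%N ->
        T i * T i.+1 * T i = T i.+1 * T i * T i.+1].

(* The presentation, expressed by its universal property. *)
Record ariki_koike := ArikiKoike {
  ak_alg :> algType F;
  ak_gen : nat -> ak_alg;
  ak_gen_relations : ak_relations ak_gen;
  ak_universal : forall (A : algType F) (t : nat -> A), ak_relations t ->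
    exists f : {lrmorphism ak_alg -> A},
      (forall i, (i < n)%N -> f (ak_gen i) = t i) /\
      (forall g : {lrmorphism ak_alg -> A},
         (forall i, (i < n)%N -> g (ak_gen i) = t i) -> g =1 f)
}.

Variable H : ariki_koike.
Local Notation T := (ak_gen H).

(* Jucys-Murphy element L_(k+1) = q^(-k) T_k ... T_1 T_0 T_1 ... T_k *)
Fixpoint jucys_murphy (k : nat) : H :=
  if k is k'.+1 then q^-1 *: (T k * jucys_murphy k' * T k) else T 0%N.

(* For 0 < i, the transposition of the (0-indexed) entries i - 1 and i, which
   corresponds to T i. *)
Definition simple_transposition (i : 'I_n) : 'S_n := tperm (ord_pred i) i.

Definition is_word_of (w : 'S_n) (s : seq 'I_n) : bool :=
  all (fun i : 'I_n => 0 < i)%N s &&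
  (w == (\prod_(i <- s) simple_transposition i)%g).

(* A shortest word for w; reduced words have length at most n (n - 1) / 2, so
   the default value is only returned if it is itself a solution. *)
Definition reduced_word (w : 'S_n) : (n ^ 2).-bseq 'I_n :=
  [arg min_(s < [bseq] | is_word_of w s) size s].

Definition T_perm (w : 'S_n) : H := \prod_(i <- reduced_word w) T i.

(* Index of the row containing the entry k in the initial tableau of shape lam
   (entries filled along rows, component after component). *)
Definition initial_row (lam : multipartition r) (k : nat) : nat :=
  reshape_index (flatten [seq parts (lam j) | j <- enum 'I_r]) k.

Definition row_stabilizer (lam : multipartition r) : {set 'S_n} :=
  [set w : 'S_n |
    [forall k : 'I_n, initial_row lam (w k) == initial_row lam k]].

(* The element m_lam = u_lam x_lam of Dipper, James and Mathas, with
   x_lam = sum of T_w over the row stabilizer and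
   u_lam = prod_(s >= 2) prod_(k = 1 .. |lam^(1)| + ... + |lam^(s-1)|)
             (L_k - Q_s);
   with components numbered from 0 the factor s = 0 is an empty product. *)
Definition specht_u (lam : multipartition r) : H :=
  \prod_(s < r) \prod_(k < \sum_(t < r | (t < s)%N) sumn (lam t))
    (jucys_murphy k - (ak_param s)%:A).

Definition specht_m (lam : multipartition r) : H :=
  specht_u lam * \sum_(w in row_stabilizer lam) T_perm w.

(* The two-sided ideal generated by the m_mu with mu strictly dominating lam,
   i.e. the span of the cellular basis elements m_(uv) of shape mu. *)
Inductive dominance_ideal (lam : multipartition r) : H -> Prop :=
| dominance_ideal0 : dominance_ideal lam 0
| dominance_ideal_gen (mu : multipartition r) (x y : H) :
    mp_size mu = n -> strictly_dominates mu lam ->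
    dominance_ideal lam (x * specht_m mu * y)
| dominance_idealD (x y : H) :
    dominance_ideal lam x -> dominance_ideal lam y ->
    dominance_ideal lam (x + y).

(* A block of H, given by its primitive central idempotent. *)
Record block := Block {
  block_idem : H;
  block_idem_central : forall x : H, block_idem * x = x * block_idem;
  block_idem_idem : block_idem * block_idem = block_idem;
  block_idem_neq0 : block_idem <> 0;
  block_idem_primitive : forall f : H,
    (forall x : H, f * x = x * f) -> f * f = f -> block_idem * f = f ->
    f = 0 \/ f = block_idem
}.

(* S^lam is the right cell module m_lam H / (m_lam H :&: dominance_ideal lam);
   it belongs to B iff the idempotent of B acts on it as the identity. *)
Definition specht_in_block (B : block) (lam : multipartition r) : Prop :=
  forall h : H,
    dominance_ideal lam (specht_m lam * h * block_idem B - specht_m lam * h).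

Definition in_block (B : block) (lam : multipartition r) : Prop :=
  mp_size lam = n /\ specht_in_block B lam.

End ArikiKoike.


Section Combinatorics.
Variables (e r : nat) (kappa : 'I_r -> int).

(* The residue i is any integer, taken modulo e. *)
Definition has_residue (i : int) (b c : nat) (j : 'I_r) : bool :=
  (kappa j + c%:Z - b%:Z == i %[mod e%:Z])%Z.

Definition residue_count (i : int) (lam : multipartition r) : nat :=
  (\sum_(j < r) \sum_(b < size (lam j)) \sum_(c < part (lam j) b)
     has_residue i b c j)%N.

Definition removable (p : partition) (b c : nat) : bool :=
  (part p b == c.+1) && (part p b.+1 <= c)%N.

Definition addable (p : partition) (b c : nat) : bool :=
  (part p b == c) && ((b == 0%N) || (c < part p b.-1)%N).

(* All removable and addable nodes of p lie in rows <= size p and in columns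
   <= part p 0. *)
Definition delta_comp (i : int) (j : 'I_r) (lam : multipartition r) : int :=
  (\sum_(b < (size (lam j)).+1) \sum_(c < (part (lam j) 0).+1)
     (removable (lam j) b c && has_residue i b c j))%N%:Z -
  (\sum_(b < (size (lam j)).+1) \sum_(c < (part (lam j) 0).+1)
     (addable (lam j) b c && has_residue i b c j))%N%:Z.

Definition hub (lam : multipartition r) (i : 'I_e) : int :=
  \sum_(j < r) delta_comp i%:Z j lam.

Definition weight (lam : multipartition r) : rat :=
  \sum_(j < r) (residue_count (kappa j) lam)%:R -
  2^-1 * \sum_(i < e) ((residue_count i%:Z lam)%:R -
                       (residue_count (i%:Z + 1) lam)%:R) ^+ 2.


Definition multicharge (a : 'I_r -> int) : Prop :=
  forall j, (a j = kappa j %[mod e%:Z])%Z.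

Definition beta_number (p : partition) (a x : int) : Prop :=
  exists m : nat, x = (part p m)%:Z + a - m.+1%:Z.

Definition bead (p : partition) (a : int) (l : 'I_e) (x : int) : Prop :=
  beta_number p a (x * e%:Z + l%:Z).

(* Every bead has a bead immediately above it; this does not depend on the
   charge. *)
Definition e_core (p : partition) : Prop :=
  forall (a : int) (l : 'I_e) (x : int), bead p a l x -> bead p a l (x - 1).

Definition multicore (lam : multipartition r) : Prop := forall j, e_core (lam j).

Definition lowest_level (p : partition) (a : int) (l : 'I_e) (x : int) : Prop :=
  bead p a l x /\ forall y, bead p a l y -> y <= x.

End Combinatorics.


Section BlockInvariants.
Variables (F : fieldType) (q : F) (e r : nat) (kappa : 'I_r -> int) (n : nat).
Variables (H : ariki_koike q kappa n) (B : block H).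

(* The hub and the weight are constant on a block, and every block contains a
   multipartition; these relations hold for exactly one d, resp. w. *)
Definition has_hub (d : 'I_e -> int) : Prop :=
  (exists lam, in_block B lam) /\
  forall lam, in_block B lam -> forall i, hub kappa lam i = d i.

Definition has_weight (w : rat) : Prop :=
  (exists lam, in_block B lam) /\
  forall lam, in_block B lam -> weight e kappa lam = w.

Definition core_block : Prop :=
  forall lam, in_block B lam -> multicore e lam.

Definition base_tuple (a : 'I_r -> int) (b : 'I_e -> int) : Prop :=
  forall (l : 'I_e) (j : 'I_r) (mu : multipartition r), in_block B mu ->
    lowest_level (mu j) (a j) l (b l) \/ lowest_level (mu j) (a j) l (b l + 1).

(* K = K_i(B), computed with the multicharge a, which is required to admit a
   base tuple; ord_pred is the cyclic predecessor, so ord_pred 0 = e - 1. *)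
Definition is_K (a : 'I_r -> int) (i : 'I_e) (K : int) : Prop :=
  exists b : 'I_e -> int,
    [/\ base_tuple a b,
        forall b', base_tuple a b' ->
          b' i <= b i /\ b (ord_pred i) <= b' (ord_pred i)
      & K = b i - b (ord_pred i) - (if i == 0%N :> nat then 2 else 1)].

End BlockInvariants.

(* Main.v *)
(* Give the position y e + l of the abacus the potential y - b_l - 1, where b is
   a base tuple of C.  For mu in C all beads have nonpositive and all empty
   positions nonnegative potential, so mu minimises the total potential of the
   beads.  An added node of residue l changes the total potential by an amount
   g_l depending only on l, with g_0 + ... + g_(e-1) = 1 and g_i = - (K + 1).
   As lam and mu have the same hub, their residue counts differ by a constant h,
   and w(B) - w(C) = h r; hence the total potential of lam exceeds that of mu by
   h <= K.  Moving a bead from runner i - 1 to an empty position of runner i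
   would lower it by K + 1, below the minimum. *)
Require Import Defs.
From HB Require Import structures.
From mathcomp Require Import all_boot all_order all_fingroup all_algebra.
From mathcomp Require Import zify ring.
Set Implicit Arguments.
Unset Strict Implicit.
Unset Printing Implicit Defensive.
Import Order.TTheory GRing.Theory Num.Theory.
Local Open Scope ring_scope.

(** * Rows of a partition and node counts by residue *)

Lemma part_nonincreasing (p : Defs.partition) (b c : nat) :
  (b <= c)%N -> (part p c <= part p b)%N.
Proof.
rewrite /part; case: p => s /= /[dup] s_part /andP[s_sorted _] le_bc.
have [le_sc|lt_cs] := leqP (size s) c; first by rewrite nth_default.
have geq_trans : transitive geq by move=> x y z /= le_xy /leq_trans; apply.
by apply: (sorted_leq_nth geq_trans leqnn 0 s_sorted);
  rewrite ?inE ?(leq_ltn_trans le_bc).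
Qed.

Lemma part_default (p : Defs.partition) (b : nat) :
  (size p <= b)%N -> part p b = 0%N.
Proof. exact: nth_default. Qed.

Definition residue_ind (e : nat) (i x : int) : int := (x == i %[mod e%:Z])%Z.

Lemma residue_ind_shift (e : nat) (i x y : int) :
  residue_ind e (i + y) (x + y) = residue_ind e i x.
Proof. by rewrite /residue_ind eqz_modDr. Qed.

Lemma sum_row_telescope (f : int -> int) (x : int) (k : nat) :
  \sum_(c < k) (f (x + c%:Z) - f (x + c%:Z - 1)) = f (x + k%:Z - 1) - f (x - 1).
Proof.
elim: k => [|k IHk]; first by rewrite big_ord0 addr0 subrr.
rewrite big_ord_recr /= IHk.
have -> : x + k.+1%:Z - 1 = x + k%:Z by lia.
by ring.
Qed.

Definition comp_count (e : nat) (i k : int) (p : Defs.partition) : int :=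
  \sum_(b < size p) \sum_(c < part p b) residue_ind e i (k + c%:Z - b%:Z).

Lemma residue_countE (e r : nat) (kappa : 'I_r -> int) (i : int)
    (lam : multipartition r) :
  (residue_count e kappa i lam)%:Z = \sum_(j < r) comp_count e i (kappa j) (lam j).
Proof.
rewrite /residue_count -natz natr_sum; apply: eq_bigr => j _.
rewrite natr_sum; apply: eq_bigr => b _.
by rewrite natr_sum; apply: eq_bigr => c _; rewrite natz.
Qed.

Lemma sum_rows_widen (p : Defs.partition) (f : nat -> nat -> int) (M : nat) :
  (size p <= M)%N ->
  \sum_(b < size p) \sum_(c < part p b) f b c =
  \sum_(b < M) \sum_(c < part p b) f b c.
Proof.
move=> le_pM.
rewrite (big_ord_widen M (fun b => \sum_(c < part p b) f b c) le_pM).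
rewrite big_mkcond; apply: eq_bigr => b _; case: ltnP => // /part_default->.
by rewrite big_ord0.
Qed.

Lemma sum_indicator (n : nat) (P : pred nat) (f : nat -> int) (k : nat) :
  (forall c, P c -> c = k) -> (P k -> (k < n)%N) ->
  \sum_(c < n) (P c)%:Z * f c = (P k)%:Z * f k.
Proof.
move=> Pk kn; have [Pk'|nPk] := boolP (P k); last first.
  rewrite big1 ?mul0r // => c _; case: (boolP (P c)) => [Pc|]; last by rewrite mul0r.
  by rewrite -(Pk _ Pc) Pc in nPk.
rewrite (bigD1 (Ordinal (kn Pk'))) //= big1 ?addr0 ?Pk' // => c.
apply: contraNeq; case: (boolP (P c)) => [/Pk ck _|]; last by rewrite mul0r eqxx.
by apply/eqP/val_inj.
Qed.

(** Residues increase by one along a row, so each difference of neighbouring counts telescopes to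
    one term at either end of every row. The right ends account for removable and addable nodes, the
    left ends leave only the corner residue [kappa j]. *)
Lemma delta_compE (e r : nat) (kappa : 'I_r -> int) (i : int) (j : 'I_r)
    (lam : multipartition r) :
  let cnt := fun i => comp_count e i (kappa j) (lam j) in
  delta_comp e kappa i j lam =
  2 * cnt i - cnt (i - 1) - cnt (i + 1) - residue_ind e i (kappa j).
Proof.
move=> cnt; set p := lam j; set k := kappa j; set X := residue_ind e i.
set M := size p.
(* [x b] is the content just beyond row [b]: that of a possible addable node there, while [x b - 1]
   belongs to the last node of a nonempty row. *)
pose x b : int := k + (part p b)%:Z - b%:Z.
have rem_sum : (\sum_(b < M.+1) \sum_(c < (part p 0).+1)
     (removable p b c && has_residue e kappa i b c j))%N%:Z =
   \sum_(b < M.+1) (part p b.+1 < part p b)%N%:Z * X (x b - 1).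
  rewrite -natz natr_sum; apply: eq_bigr => b _; rewrite natr_sum.
  transitivity (\sum_(c < (part p 0).+1) (removable p b c)%:Z * X (k + c%:Z - b%:Z)).
    by apply: eq_bigr => c _; rewrite natz -mulnb PoszM.
  rewrite (@sum_indicator _ (removable p b) (fun c => X (k + c%:Z - b%:Z))
    (part p b).-1).
  - rewrite /removable; case: (ltnP (part p b.+1) (part p b)) => h.
      have -> : [&& part p b == (part p b).-1.+1 & (part p b.+1 <= (part p b).-1)%N] by lia.
      by rewrite /x; congr (_ * X _); lia.
    have -> : [&& part p b == (part p b).-1.+1 & (part p b.+1 <= (part p b).-1)%N] = false by lia.
    by rewrite !mul0r.
  - by rewrite /removable => c; lia.
  - by move=> _; have := @part_nonincreasing p 0 b; lia.
have add_sum : (\sum_(b < M.+1) \sum_(c < (part p 0).+1)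
     (addable p b c && has_residue e kappa i b c j))%N%:Z =
   \sum_(b < M.+1) ((b == 0%N :> nat) || (part p b < part p b.-1)%N)%:Z * X (x b).
  rewrite -natz natr_sum; apply: eq_bigr => b _; rewrite natr_sum.
  transitivity (\sum_(c < (part p 0).+1) (addable p b c)%:Z * X (k + c%:Z - b%:Z)).
    by apply: eq_bigr => c _; rewrite natz -mulnb PoszM.
  rewrite (@sum_indicator _ (addable p b) (fun c => X (k + c%:Z - b%:Z)) (part p b)).
  - by rewrite /addable eqxx.
  - by move=> c /andP[/eqP].
  - by move=> _; have := @part_nonincreasing p 0 b; lia.
rewrite /delta_comp rem_sum add_sum.
have cntE i' : cnt i' =
    \sum_(b < M.+1) \sum_(c < part p b) residue_ind e i' (k + c%:Z - b%:Z).
  exact: (sum_rows_widen (fun b c => residue_ind e i' (k + c%:Z - b%:Z)) (leqnSn _)).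
have up : cnt i - cnt (i + 1) =
    \sum_(b < M.+1) (X (x b - 1) - X (k - b%:Z - 1)).
  rewrite !cntE -sumrB; apply: eq_bigr => b _; rewrite -sumrB.
  have -> : x b - 1 = (k - b%:Z) + (part p b)%:Z - 1 by rewrite /x; lia.
  rewrite -sum_row_telescope; apply: eq_bigr => c _.
  rewrite /X -(residue_ind_shift e i (k - b%:Z + c%:Z - 1) 1).
  by congr (residue_ind _ _ _ - residue_ind _ _ _); lia.
have down : cnt i - cnt (i - 1) =
    \sum_(b < M.+1) (X (k - b%:Z) - X (x b)).
  rewrite !cntE -sumrB; apply: eq_bigr => b _; rewrite -sumrB.
  transitivity (- \sum_(c < part p b)
     (X ((k - b%:Z + 1) + c%:Z) - X ((k - b%:Z + 1) + c%:Z - 1))).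
    rewrite -sumrN; apply: eq_bigr => c _.
    rewrite -(residue_ind_shift e (i - 1) _ 1) subrK opprB.
    by congr (residue_ind _ _ _ - residue_ind _ _ _); lia.
  rewrite sum_row_telescope opprB.
  by congr (X _ - X _); rewrite /x; lia.
have -> : 2 * cnt i - cnt (i - 1) - cnt (i + 1) =
   (cnt i - cnt (i + 1)) + (cnt i - cnt (i - 1)) by ring.
rewrite {}up {}down !sumrB.
(* The two left-end sums differ by a shift of one row, so only extreme terms survive; the one at
   [k - M - 1] cancels against [rows]. *)
have vac : \sum_(b < M.+1) X (k - b%:Z) =
    X k + \sum_(b < M.+1) X (k - b%:Z - 1) - X (k - M%:Z - 1).
  rewrite big_ord_recl [in RHS]big_ord_recr /= subr0 addrA addrK; congr (_ + _).
  by apply: eq_bigr => b _; congr X; rewrite /bump /=; lia.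
(* A row of the same length as the next one is not removable and makes the
   next one not addable; the two corresponding residues agree. *)
have rows : \sum_(b < M.+1) (part p b.+1 < part p b)%N%:Z * X (x b - 1) -
    \sum_(b < M.+1) ((b == 0%N :> nat) || (part p b < part p b.-1)%N)%:Z * X (x b) =
    \sum_(b < M.+1) X (x b - 1) - \sum_(b < M.+1) X (x b) - X (k - M%:Z - 1).
  rewrite [X in X - _ = _]big_ord_recr [X in _ - X = _]big_ord_recl.
  rewrite [X in _ = X - _ - _]big_ord_recr [X in _ = _ - X - _]big_ord_recl /=.
  have -> : (part p M.+1 < part p M)%N = false by rewrite !part_default /M.
  have -> : x M = k - M%:Z by rewrite /x part_default ?addr0.
  have -> : \sum_(b < M) X (x b - 1) =
     \sum_(b < M) (part p b.+1 < part p b)%N%:Z * X (x b - 1) +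
     \sum_(b < M) (X (x b.+1) - (part p b.+1 < part p b)%N%:Z * X (x b.+1)).
    rewrite -big_split; apply: eq_bigr => b _ /=.
    have := @part_nonincreasing p b b.+1 (leqnSn _); rewrite leq_eqVlt.
    case: ltnP => //= _; first by rewrite !mul1r subrr addr0.
    rewrite orbF => /eqP ebb; rewrite !mul0r add0r subr0.
    by congr X; rewrite /x ebb; lia.
  rewrite sumrB mul0r mul1r addr0 /bump /=.
  by ring.
rewrite rows vac; ring.
Qed.

(** * Multipartitions with equal hub *)

Lemma residue_count_mod (e r : nat) (kappa : 'I_r -> int) (i i' : int)
    (lam : multipartition r) :
  (i = i' %[mod e%:Z])%Z -> residue_count e kappa i lam = residue_count e kappa i' lam.
Proof.
move=> eq_ii'; apply: eq_bigr => j _; apply: eq_bigr => b _.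
by apply: eq_bigr => c _; rewrite /has_residue eq_ii'.
Qed.

Lemma hubE (e r : nat) (kappa : 'I_r -> int) (i : 'I_e) (lam : multipartition r) :
  let cnt := fun i : int => (residue_count e kappa i lam)%:Z in
  hub kappa lam i = 2 * cnt i%:Z - cnt (i%:Z - 1) - cnt (i%:Z + 1) -
                    \sum_(j < r) residue_ind e i%:Z (kappa j).
Proof.
rewrite /= !residue_countE mulr_sumr -!sumrB.
by apply: eq_bigr => j _; rewrite delta_compE.
Qed.

(* By hubE the difference of the residue counts is affine in i, hence constant
   because it is periodic. *)
Lemma residue_count_diff (e r : nat) (kappa : 'I_r -> int)
    (lam mu : multipartition r) :
  (0 < e)%N -> (forall i : 'I_e, hub kappa lam i = hub kappa mu i) ->
  exists h : int, forall i : int,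
    (residue_count e kappa i lam)%:Z = (residue_count e kappa i mu)%:Z + h.
Proof.
move=> e_gt0 eq_hub.
pose D i : int := (residue_count e kappa i lam)%:Z - (residue_count e kappa i mu)%:Z.
have D_mod i i' : (i = i' %[mod e%:Z])%Z -> D i = D i'.
  by move=> eq_ii'; rewrite /D !(residue_count_mod _ _ eq_ii').
have D_second n : (n < e)%N -> D (n%:Z + 1) = 2 * D n%:Z - D (n%:Z - 1).
  by move=> lt_ne; have := eq_hub (Ordinal lt_ne); rewrite !hubE /D /=; lia.
(* The recurrence has order two, so the induction carries two consecutive values. *)
have D_affine n : (n <= e)%N ->
    D n%:Z = D 0 + n%:Z * (D 0 - D (-1)) /\
    D (n%:Z - 1) = D 0 + (n%:Z - 1) * (D 0 - D (-1)).
  elim: n => [|n IHn] lt_ne; first by rewrite sub0r; split; ring.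
  have [IH0 IH1] := IHn (ltnW lt_ne).
  have -> : n.+1%:Z - 1 = n%:Z by lia.
  split; last by rewrite IH0.
  have -> : n.+1%:Z = n%:Z + 1 by lia.
  by rewrite D_second // IH0 IH1; ring.
have De : D e%:Z = D 0 by apply: D_mod; rewrite modzz mod0z.
have step0 : D 0 - D (-1) = 0.
  have [] := D_affine e (leqnn e); rewrite De => /eqP.
  rewrite addrC eq_sym -subr_eq0 addrK mulf_eq0 eqz_nat.
  by rewrite eqn0Ngt e_gt0 => /eqP.
exists (D 0) => i; suff <- : D i = D 0 by rewrite /D; ring.
have e_neq0 : e%:Z != 0 by rewrite eqz_nat -lt0n.
have := modz_ge0 i e_neq0; have := ltz_pmod i (d := e%:Z).
case Ei: (i %% e%:Z)%Z => [n|//] /(_ e_gt0) lt_ne _.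
have -> : D i = D n%:Z by apply: D_mod; rewrite -Ei modz_mod.
by have [-> _] := D_affine n (ltnW lt_ne); rewrite step0 mulr0 addr0.
Qed.

(** A common shift cancels in the squared differences and enters each of the [r] linear terms
    once. *)
Lemma weight_diff (e r : nat) (kappa : 'I_r -> int) (lam mu : multipartition r)
    (h : int) :
  (forall i : int,
    (residue_count e kappa i lam)%:Z = (residue_count e kappa i mu)%:Z + h) ->
  weight e kappa lam = weight e kappa mu + h%:~R * r%:R.
Proof.
move=> Dh; have Dq i : (residue_count e kappa i lam)%:R =
    (residue_count e kappa i mu)%:R + h%:~R :> rat.
  by rewrite !pmulrn Dh intrD.
rewrite /weight (eq_bigr _ (fun j _ => Dq (kappa j))) big_split /=.
rewrite sumr_const card_ord mulr_natr addrAC; congr (_ - _ * _ + _).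
by apply: eq_bigr => i _; rewrite !Dq; congr (_ ^+ 2); ring.
Qed.

(** * Beta-numbers and sums over beads *)

Definition beta (p : Defs.partition) (a : int) (k : nat) : int :=
  (part p k)%:Z + a - k.+1%:Z.

Lemma beta_inj (p : Defs.partition) (a : int) : injective (beta p a).
Proof.
move=> k k'; rewrite /beta.
by case: (leqP k k') => [|/ltnW] /[dup] /(part_nonincreasing p); lia.
Qed.

(** Rows from [M] on are empty and give beta-numbers below [a - M], so above that bound a finite
    list decides. *)
Lemma beta_numberN (p : Defs.partition) (a x : int) (M : nat) :
  (size p <= M)%N -> a - M%:Z <= x -> x \notin [seq beta p a k | k <- iota 0 M] ->
  ~ beta_number p a x.
Proof.
move=> le_pM le_x /negP x_notin [k xE]; apply: x_notin; rewrite {}xE in le_x *.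
apply: (map_f (beta p a)); rewrite mem_iota /=; have [//|le_Mk] := ltnP k M.
by move: le_x; rewrite part_default; lia.
Qed.

Lemma beta_number_shift (p : Defs.partition) (a a' x : int) :
  beta_number p a x <-> beta_number p a' (x + a' - a).
Proof. by split=> -[m hx]; exists m; lia. Qed.

(* The nodes of row k move a bead from its position a - k - 1 in the abacus of
   the empty partition to beta p a k, one step at a time. *)
Lemma comp_sum_potential (f : int -> int) (p : Defs.partition) (a : int) (M : nat) :
  (size p <= M)%N ->
  \sum_(b < size p) \sum_(c < part p b)
    (f (a + c%:Z - b%:Z) - f (a + c%:Z - b%:Z - 1)) =
  \sum_(k < M) f (beta p a k) - \sum_(k < M) f (a - k.+1%:Z).
Proof.
move=> le_pM.
rewrite (sum_rows_widen (fun b c => f (a + c%:Z - b%:Z) - f (a + c%:Z - b%:Z - 1)) le_pM).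
rewrite -sumrB; apply: eq_bigr => b _.
have -> : beta p a b = (a - b%:Z) + (part p b)%:Z - 1 by rewrite /beta; lia.
have -> : a - b.+1%:Z = a - b%:Z - 1 by lia.
rewrite -sum_row_telescope; apply: eq_bigr => c _.
by rewrite [a - _ + _]addrAC.
Qed.

(** Common elements cancel; what is left of [Y] contributes at most 0, what is left of [X] at least
    0. *)
Lemma sum_seq_min (X Y : seq int) (f : int -> int) :
  uniq X -> uniq Y ->
  (forall y, y \in Y -> f y <= 0) ->
  (forall x, x \in X -> x \notin Y -> 0 <= f x) ->
  \sum_(y <- Y) f y <= \sum_(x <- X) f x.
Proof.
move=> uX uY fY fX.
rewrite (bigID (mem X)) [leRHS](bigID (mem Y)) /=; apply: lerD; last first.
  apply: (@le_trans _ _ 0).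
    by rewrite big_seq_cond; apply: sumr_le0 => y /andP[/fY].
  by rewrite big_seq_cond; apply: sumr_ge0 => x /andP[]; apply: fX.
rewrite -big_filter -[leRHS]big_filter le_eqVlt; apply/orP; left; apply/eqP/perm_big.
by apply: uniq_perm; rewrite ?filter_uniq // => x; rewrite !mem_filter andbC.
Qed.

(** * The potential of abacus positions *)

Section Potential.
Variables (e : nat) (b : 'I_e -> int).

(* Normalised so that the beads of a multipartition of the core block are at
   positions of nonpositive potential and its empty positions at nonnegative
   ones. *)
Definition potential (x : int) : int :=
  (x %/ e%:Z)%Z - \sum_(l < e | (x == l%:Z %[mod e%:Z])%Z) b l - 1.

(** A node moves a bead to a position [x] congruent to its residue, so for [x] of residue [l] this
    is the [g_l] of the overview. *)
Definition potential_step (x : int) : int := potential x - potential (x - 1).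

Lemma potentialE (l : 'I_e) (y : int) : potential (y * e%:Z + l%:Z) = y - b l - 1.
Proof.
have e_gt0 : (0 < e)%N by apply: leq_ltn_trans (ltn_ord l).
have e_neq0 : e%:Z != 0 by rewrite eqz_nat -lt0n.
have small (l' : 'I_e) : (l'%:Z %% e%:Z)%Z = l'%:Z by rewrite modz_small ?ltz_nat ?ltn_ord.
rewrite /potential divzMDl // divz_small ?ltz_nat ?ltn_ord ?addr0 //.
rewrite (big_pred1 l) // => l'.
by rewrite modzMDl !small eqz_nat eq_sym.
Qed.

Lemma potential_shift (x : int) (t : int) : (0 < e)%N ->
  potential (x + t * e%:Z) = potential x + t.
Proof.
move=> e_gt0; have e_neq0 : e%:Z != 0 by rewrite eqz_nat -lt0n.
rewrite /potential [x + _]addrC divzMDl // (eq_bigl (fun l : 'I_e => (x == l%:Z %[mod e%:Z])%Z)).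
  by ring.
by move=> l; rewrite modzMDl.
Qed.

Lemma potential_step_mod (x y : int) : (0 < e)%N ->
  (x = y %[mod e%:Z])%Z -> potential_step x = potential_step y.
Proof.
move=> e_gt0 eq_xy; rewrite /potential_step (divz_eq x e%:Z) eq_xy.
rewrite [in RHS](divz_eq y e%:Z).
rewrite ![_ * _ + _]addrC -![_ + _ * _ - 1]addrAC !potential_shift //; ring.
Qed.

(** The sum telescopes to the change over [e] positions, that is, one level down a runner. *)
Lemma sum_potential_step : (0 < e)%N -> \sum_(l < e) potential_step l%:Z = 1.
Proof.
move=> e_gt0; have := sum_row_telescope potential 0 e.
have -> : 0 + e%:Z - 1 = - 1 + 1 * e%:Z by lia.
rewrite potential_shift // sub0r [_ + 1 - _]addrAC subrr add0r => <-.
by apply: eq_bigr => l _; rewrite add0r.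
Qed.

Lemma sum_step_indicator (x : int) : (0 < e)%N ->
  \sum_(l < e) potential_step l%:Z * residue_ind e l%:Z x = potential_step x.
Proof.
move=> e_gt0; have e_neq0 : e%:Z != 0 by rewrite eqz_nat -lt0n.
have := modz_ge0 x e_neq0; have := ltz_pmod x (d := e%:Z).
case Ex: (x %% e%:Z)%Z => [n|//] /(_ e_gt0) lt_ne _.
rewrite (bigD1 (Ordinal lt_ne)) //= big1 ?addr0 => [|l neq_l].
  have eq_xn : (x = n%:Z %[mod e%:Z])%Z by rewrite -Ex modz_mod.
  by rewrite /residue_ind eq_xn eqxx mulr1; apply: potential_step_mod.
rewrite /residue_ind Ex modz_small ?ltz_nat ?ltn_ord // eqz_nat.
by rewrite eq_sym -[n]/(val (Ordinal lt_ne)) val_eqE (negPf neq_l) mulr0.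
Qed.

(** The total potential relative to the empty multipartition, computed once by nodes and once by
    beads. *)
Lemma weighted_residue_count (r : nat) (kappa : 'I_r -> int) (a : 'I_r -> int)
    (lam : multipartition r) (M : nat) :
  (0 < e)%N -> multicharge e kappa a -> (forall j, size (lam j) <= M)%N ->
  \sum_(l < e) potential_step l%:Z * (residue_count e kappa l%:Z lam)%:Z =
  \sum_(j < r) (\sum_(k < M) potential (beta (lam j) (a j) k) -
                \sum_(k < M) potential (a j - k.+1%:Z)).
Proof.
move=> e_gt0 charge_a le_M.
under eq_bigr => l _ do rewrite residue_countE mulr_sumr.
rewrite exchange_big; apply: eq_bigr => j _ /=.
rewrite -comp_sum_potential //.
under eq_bigr => l _ do rewrite mulr_sumr.
rewrite exchange_big; apply: eq_bigr => k _ /=.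
under eq_bigr => l _ do rewrite mulr_sumr.
rewrite exchange_big; apply: eq_bigr => c _ /=.
rewrite sum_step_indicator //; apply: potential_step_mod => //.
by apply/eqP; rewrite -!addrA eqz_modDr; apply/eqP/esym/charge_a.
Qed.

(** * Minimality of the potential for cores *)

Lemma runner_level (x : int) : (0 < e)%N ->
  exists (l : 'I_e) (y : int), x = y * e%:Z + l%:Z.
Proof.
move=> e_gt0; have e_neq0 : e%:Z != 0 by rewrite eqz_nat -lt0n.
have := modz_ge0 x e_neq0; have := ltz_pmod x (d := e%:Z).
case Ex: (x %% e%:Z)%Z => [n|//] /(_ e_gt0) lt_ne _.
by exists (Ordinal lt_ne), (x %/ e%:Z)%Z; rewrite {1}(divz_eq x e%:Z) Ex.
Qed.

Lemma bead_up (p : Defs.partition) (a : int) (l : 'I_e) (x y : int) :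
  e_core e p -> bead p a l x -> y <= x -> bead p a l y.
Proof.
move=> core_p bead_x le_yx; have -> : y = x - `|x - y|%N%:Z by lia.
elim: `|x - y|%N => [|n IHn]; first by rewrite subr0.
have -> : x - n.+1%:Z = x - n%:Z - 1 by lia.
exact: core_p.
Qed.

Section Core.
Variables (p : Defs.partition) (a : int).
Hypothesis core_p : e_core e p.
Hypothesis lowest_p : forall l : 'I_e,
  lowest_level p a l (b l) \/ lowest_level p a l (b l + 1).

Lemma potential_bead (x : int) : (0 < e)%N -> beta_number p a x -> potential x <= 0.
Proof.
move=> e_gt0; have [l [y ->]] := runner_level x e_gt0 => bead_y.
by rewrite potentialE; case: (lowest_p l) => -[_ /(_ y bead_y)]; lia.
Qed.

Lemma potential_empty (x : int) : (0 < e)%N -> ~ beta_number p a x -> 0 <= potential x.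
Proof.
move=> e_gt0; have [l [y ->]] := runner_level x e_gt0 => empty_y.
rewrite potentialE; have [lt_by|le_yb] := ltrP (b l) y; first lia.
by case: empty_y; case: (lowest_p l) => -[bead_l _]; apply: (bead_up core_p bead_l); lia.
Qed.

(** [phi] is any placement of [M] distinct beads. The lower bound keeps it off the positions below
    [a - M], which hold beads of [p] missing from the truncated list. *)
Lemma core_potential_min (M : nat) (phi : nat -> int) :
  (0 < e)%N -> (size p <= M)%N -> injective phi ->
  (forall k, (k < M)%N -> a - M%:Z <= phi k) ->
  \sum_(k < M) potential (beta p a k) <= \sum_(k < M) potential (phi k).
Proof.
move=> e_gt0 le_pM phi_inj phi_ge.
have asseq (g : nat -> int) : \sum_(k < M) potential (g k) =
    \sum_(x <- [seq g k | k <- iota 0 M]) potential x.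
  by rewrite big_map -[M in iota 0 M]subn0 big_mkord.
rewrite !asseq; apply: sum_seq_min.
- by rewrite map_inj_uniq ?iota_uniq.
- by rewrite map_inj_uniq ?iota_uniq //; apply: beta_inj.
- by move=> _ /mapP[k _ ->]; apply: potential_bead => //; exists k.
- move=> x /mapP[k]; rewrite mem_iota => /= lt_kM -> notY.
  by apply: potential_empty => //; apply: beta_numberN notY; rewrite ?phi_ge.
Qed.
End Core.
End Potential.

(** * Moving a bead, and the conclusion *)

Lemma core_block_no_addable (e r : nat) (kappa a : 'I_r -> int) (b : 'I_e -> int)
    (lam mu : multipartition r) (h : int) (j : 'I_r) (x : int) :
  (0 < e)%N -> multicharge e kappa a -> multicore e mu ->
  (forall (l : 'I_e) j,
     lowest_level (mu j) (a j) l (b l) \/ lowest_level (mu j) (a j) l (b l + 1)) ->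
  (forall i : int,
    (residue_count e kappa i lam)%:Z = (residue_count e kappa i mu)%:Z + h) ->
  h + potential_step b (x + 1) < 0 ->
  beta_number (lam j) (a j) x -> beta_number (lam j) (a j) (x + 1).
Proof.
move=> e_gt0 charge_a core_mu lowest_mu Dh h_small [m xE].
have [//|empty] : beta_number (lam j) (a j) (x + 1) \/
                  ~ beta_number (lam j) (a j) (x + 1).
  (* The window must reach down to [x + 1] for its list of beads to decide membership. *)
  pose M := (size (lam j) + `|a j - x|)%N.
  have [|no] := boolP (x + 1 \in [seq beta (lam j) (a j) k | k <- iota 0 M]).
    by case/mapP => k _ ->; left; exists k.
  by right; apply: beta_numberN no; rewrite /M; lia.
exfalso.
pose M := (m.+1 + \sum_(i < r) (size (lam i) + size (mu i)))%N.
have le_M i : (size (lam i) <= M)%N /\ (size (mu i) <= M)%N.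
  by rewrite /M (bigD1 i) //=; split; lia.
have lt_mM : (m < M)%N by rewrite /M; lia.
(* Since the steps sum to 1, applying this to [lam] and [mu] shows that their total potentials
   differ by exactly [h]. *)
have := weighted_residue_count b e_gt0 charge_a (fun i => (le_M i).1).
under eq_bigr => l _ do rewrite Dh mulrDr.
rewrite big_split -mulr_suml /=.
rewrite (sum_potential_step b e_gt0) mul1r.
rewrite (weighted_residue_count b e_gt0 charge_a (fun i => (le_M i).2)).
rewrite !sumrB => eqh.
have beta_m : beta (lam j) (a j) m = x by rewrite xE.
(* The beads of [lam] with the one at [x] moved to [x + 1]; this stays injective because [x + 1] is
   empty. Its potential exceeds that of [mu] by [h + potential_step b (x + 1) < 0], against
   minimality. *)
pose phi i k : int :=
  if (i == j) && (k == m) then x + 1 else beta (lam i) (a i) k.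
have phi_inj i : injective (phi i).
  move=> k k'; rewrite /phi; case: eqP => [->|_] /=; last exact: beta_inj.
  case: eqP => [->|_]; case: eqP => [->|_] // eqx; last exact: (beta_inj eqx).
    by case: empty; exists k'.
  by case: empty; exists k.
have phi_ge i k : (k < M)%N -> a i - M%:Z <= phi i k.
  rewrite /phi /beta => lt_kM; case: ifP => [/andP[/eqP-> _]|_]; last lia.
  by move: xE; lia.
have : \sum_(i < r) \sum_(k < M) potential b (beta (mu i) (a i) k) <=
       \sum_(i < r) \sum_(k < M) potential b (phi i k).
  apply: ler_sum => i _.
  by apply: core_potential_min => //; [case: (le_M i) | apply: phi_ge].
have -> : \sum_(i < r) \sum_(k < M) potential b (phi i k) =
   \sum_(i < r) \sum_(k < M) potential b (beta (lam i) (a i) k) +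
   potential_step b (x + 1).
  rewrite (bigD1 j) //= [in RHS](bigD1 j) //=.
  rewrite (bigD1 (Ordinal lt_mM)) //= [in RHS](bigD1 (Ordinal lt_mM)) //=.
  rewrite {1}/phi !eqxx /= beta_m /potential_step addrK.
  rewrite (eq_bigr (fun k : 'I_M => potential b (beta (lam j) (a j) k))); last first.
    by move=> k neq_k; rewrite /phi -(inj_eq val_inj) /= in neq_k *; rewrite (negPf neq_k) andbF.
  rewrite (eq_bigr (fun i => \sum_(k < M) potential b (beta (lam i) (a i) k))); last first.
    by move=> i neq_i; apply: eq_bigr => k _; rewrite /phi (negPf neq_i).
  by ring.
move: eqh h_small.
set S_vac := \sum_(i < r) \sum_(k < M) potential b (a i - k.+1%:Z).
set S_mu := \sum_(i < r) \sum_(k < M) potential b (beta (mu i) (a i) k).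
set S_lam := \sum_(i < r) \sum_(k < M) potential b (beta (lam i) (a i) k).
by lia.
Qed.

Theorem lemma5p3 (F : fieldType) (e : nat) (q : F) (r : nat)
  (kappa : 'I_r -> int)
  (he : (2 <= e)%N) (hq : e.-primitive_root q) (hr : (1 <= r)%N)
  (i : 'I_e)
  (* the block B of H_(r,n) *)
  (n : nat) (Hn : ariki_koike q kappa n) (B : block Hn)
  (d : 'I_e -> int) (hubB : has_hub B d)
  (wB : rat) (weightB : has_weight e B wB)
  (delta_ge0 : 0 <= d i)
  (* its core block C, a block of some H_(r,m) *)
  (m : nat) (Hm : ariki_koike q kappa m) (C : block Hm)
  (coreC : core_block e C) (hubC : has_hub C d)
  (wC : rat) (weightC : has_weight e C wC)
  (* the multicharge fixed to define K_i(C) *)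
  (a0 : 'I_r -> int) (charge_a0 : multicharge e kappa a0)
  (K : int) (KC : is_K C a0 i K)
  (weight_le : wB <= wC + K%:~R * r%:R)
  (* a multipartition in B, and the multicharge used for its beta-numbers *)
  (lam : multipartition r) (lamB : in_block B lam)
  (a : 'I_r -> int) (charge_a : multicharge e kappa a) :
  (i <> 0%N :> nat ->
     ~ exists (j : 'I_r) (b : int),
         [/\ (b = i%:Z - 1 %[mod e%:Z])%Z,
             beta_number (lam j) (a j) b
           & ~ beta_number (lam j) (a j) (b + 1)]) /\
  (i = 0%N :> nat ->
     ~ exists (j : 'I_r) (b : int),
         [/\ (b = e%:Z - 1 %[mod e%:Z])%Z,
             beta_number (lam j) (a j) b,
             ~ beta_number (lam j) (a j) (b + 1)
           & ~ beta_number (lam j) (a j) (b + e%:Z + 1)]).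
Proof.
have e_gt0 : (0 < e)%N by apply: leq_trans he.
have [[mu muC] hub_mu] := hubC.
have [b [base_b _ KE]] := KC.
have [h Dh] : exists h : int, forall i : int,
    (residue_count e kappa i lam)%:Z = (residue_count e kappa i mu)%:Z + h.
  by apply: residue_count_diff => // l; rewrite (hub_mu mu) ?(hubB.2 lam).
(* The weights differ by [h * r], and [r] is positive. *)
have le_hK : h <= K.
  move: weight_le; rewrite -(weightB.2 _ lamB) -(weightC.2 _ muC) (weight_diff Dh).
  by rewrite lerD2l ler_pM2r ?ltr0n // ler_int.
have stepE : potential_step b i%:Z = - (K + 1).
  have i_pos : i%:Z = 0 * e%:Z + i%:Z by ring.
  rewrite /potential_step {1}i_pos potentialE KE.
  (* For [i = 0] the preceding position is on runner [e - 1] one level higher, which is why [K] then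
     subtracts 2 instead of 1. *)
  have predE : i%:Z - 1 = (if i == 0%N :> nat then -1 else 0) * e%:Z + (ord_pred i)%:Z.
    rewrite /=; case: eqP => [->|/eqP i_neq0].
      by rewrite add0n modn_small; lia.
    have -> : (i + e).-1 = (i.-1 + e)%N by lia.
    by have lt_ie := ltn_ord i; rewrite modnDr modn_small; lia.
  by rewrite predE potentialE; case: ifP => _; ring.
have no_addable j x : (x = i%:Z - 1 %[mod e%:Z])%Z ->
    beta_number (lam j) (a j) x -> beta_number (lam j) (a j) (x + 1).
  (* The base tuple refers to [a0]; passing from [a] to [a0] translates the abacus by a multiple of
     [e], which preserves runners. *)
  move=> eq_xi /(beta_number_shift _ _ (a0 j)) bead_x.
  apply/(beta_number_shift _ _ (a0 j)).
  have -> : x + 1 + a0 j - a j = x + a0 j - a j + 1 by ring.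
  have lowest_mu l k : lowest_level (mu k) (a0 k) l (b l) \/
      lowest_level (mu k) (a0 k) l (b l + 1) by apply: base_b.
  apply: (core_block_no_addable e_gt0 charge_a0 (coreC mu muC) lowest_mu Dh _ bead_x).
  rewrite (@potential_step_mod _ b _ i%:Z) ?stepE //; first lia.
  have : (x + (a0 j - a j) = i%:Z - 1 + 0 %[mod e%:Z])%Z.
    rewrite -modzDml eq_xi modzDml; apply/eqP; rewrite eqz_modDl.
    by rewrite eqz_mod_dvd subr0 -eqz_mod_dvd charge_a0 charge_a.
  move/eqP; rewrite -(eqz_modDr 1) => /eqP.
  by rewrite addr0 subrK addrA.
split=> [_|i0] [j [x []]]; first by move=> /no_addable H /H.
move=> eq_x bead_x empty _; apply: empty; apply: no_addable => //.
by rewrite eq_x i0 sub0r addrC modzDr.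
Qed.
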